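(* For every $\varepsilon>0$ there exists $c>0$ such that if $p=p(n)\ge(1+\varepsilon)\log n/n$, then $G\sim G(n,n,p)$ admits, with probability tending to $1$ as $n\to\infty$, a strong bipartite $d$-rigid partition for $d=\min\{cnp/\log(np),\,0.8\sqrt n\}$.
   Context: $G(n,n,p)$ is the random bipartite graph with parts $A,B$ of size $n$ each, in which each pair in $A\times B$ is an edge independently with probability $p$. For $X,Y\subseteq V$, $G[X,Y]$ is the graph on $X\cup Y$ with the edges of $G$ having one endpoint in $X$ and the other in $Y$. A partition $V_1,\dots,V_{d+1}$ of $V=A\cup B$ into nonempty sets, with $A_i=V_i\cap A$, $B_i=V_i\cap B$, is a strong bipartite $d$-rigid partition if $G[A_i,B_j]$ is connected for all $i\ne j$, and there is a sequence $0\le s_1\le\dots\le s_{d+1}$ with $\sum_{i=1}^k s_i\ge\binom k2$ for all $1\le k\le d+1$ such that each $G[A_i,B_i]$ contains a forest with $s_i$ edges. Logarithms are natural; floors and ceilings are omitted. *)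

(* Defs.v *)
From HB Require Import structures.
From mathcomp Require Import all_boot all_order all_algebra.
From mathcomp Require Import all_classical all_reals all_analysis.

Set Implicit Arguments.
Unset Strict Implicit.
Unset Printing Implicit Defensive.

Import Order.TTheory GRing.Theory Num.Theory.
Import numFieldNormedType.Exports.

Local Open Scope ring_scope.

(* A bipartite graph with parts A and B is given by its edge set E : {set A * B};
   its vertex type is the disjoint sum A + B. *)
Section BipartiteGraphs.
Variables A B : finType.
Implicit Types (E F : {set A * B}) (X Y : {set A + B}).

Definition adj E : rel (A + B) := fun u v =>
  match u, v with
  | inl a, inr b => (a, b) \in E
  | inr b, inl a => (a, b) \in E
  | _, _ => false
  end.

(* The edge set of G[X, Y]; the vertex set of G[X, Y] is X :|: Y. *)
Definition edges_between E X Y : {set A * B} :=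
  [set e in E | ((inl e.1 \in X) && (inr e.2 \in Y))
             || ((inl e.1 \in Y) && (inr e.2 \in X))]%SET.

(* A connected graph is required to have at least one vertex. *)
Definition connected_between E X Y : Prop :=
  (X :|: Y)%SET != finset.set0 /\
  forall u v, u \in (X :|: Y)%SET -> v \in (X :|: Y)%SET ->
    connect (adj (edges_between E X Y)) u v.

(* Since [ucycle] also accepts the empty sequence and an edge traversed back and
   forth, genuine cycles are those of size at least 3. *)
Definition is_forest F : Prop :=
  forall c : seq (A + B), ucycle (adj F) c -> (size c < 3)%N.

Definition contains_forest_between E X Y (s : nat) : Prop :=
  exists F : {set A * B},
    [/\ F \subset edges_between E X Y, is_forest F & #|F| = s].

Definition partA : {set A + B} := [set inl a | a : A]%SET.
Definition partB : {set A + B} := [set inr b | b : B]%SET.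

Definition is_indexed_partition (m : nat) (V : 'I_m -> {set A + B}) : Prop :=
  [/\ forall i, V i != finset.set0,
      forall i j, i != j -> [disjoint V i & V j]
    & forall v, exists i, v \in V i].

(* Indices are shifted: V_1, ..., V_{d+1} and s_1, ..., s_{d+1} are indexed by
   0, ..., d, so that s_1 + ... + s_k is the sum over the indices i < k. *)
Definition strong_bipartite_rigid_partition E (d : nat)
    (V : 'I_d.+1 -> {set A + B}) : Prop :=
  [/\ is_indexed_partition V,
      forall i j, i != j ->
        connected_between E (V i :&: partA)%SET (V j :&: partB)%SET
    & exists s : 'I_d.+1 -> nat,
        [/\ forall i j : 'I_d.+1, (i <= j)%N -> (s i <= s j)%N,
            forall k, (1 <= k <= d.+1)%N ->
              ('C(k, 2) <= \sum_(i < d.+1 | (i < k)%N) s i)%N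
          & forall i,
              contains_forest_between E (V i :&: partA)%SET (V i :&: partB)%SET
                (s i)]].

Definition admits_strong_bipartite_rigid_partition E (d : nat) : Prop :=
  exists V : 'I_d.+1 -> {set A + B}, strong_bipartite_rigid_partition E V.

End BipartiteGraphs.

Section RandomBipartiteGraph.
Variables (R : realType) (n : nat) (p : R).

Definition Gnnp_weight (E : {set 'I_n * 'I_n}) : R :=
  \prod_(e : 'I_n * 'I_n) (if e \in E then p else 1 - p).

Definition Gnnp_prob (P : {set 'I_n * 'I_n} -> Prop) : R :=
  \sum_(E : {set 'I_n * 'I_n} | `[< P E >]) Gnnp_weight E.

Definition rigid_dim (c : R) : nat :=
  Num.truncn (Num.min (c * (n%:R * p) / ln (n%:R * p))
                      (8%:R / 10%:R * Num.sqrt n%:R)).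

Lemma Gnnp_weight_sum1 : \sum_(E : {set 'I_n * 'I_n}) Gnnp_weight E = 1.
Proof.
transitivity (\prod_(e : 'I_n * 'I_n) (p + (1 - p))); last first.
  by rewrite big1 // => e _; rewrite addrC subrK.
by rewrite bigA_distr.
Qed.

End RandomBipartiteGraph.

(* Main.v *)
(* Write q = np. With high probability all degrees have order q, any two vertex
   sets of size m ~ ln q / p on opposite sides span an edge, and smaller sets
   span few edges. Colour A and B independently with d + 1 = O(q / ln q) colours.
   A vertex has fewer than half of the expected number of neighbours in some
   colour with probability q^(-K), K large, and such events depend on each other
   only for vertices with a common neighbour, so on at most O(q^2) others. By the
   Lovasz local lemma some colouring gives every vertex a positive proportion of
   its degree in each opposite colour class. Double counting makes the classes
   large. If G[A_i, B_j] were disconnected, two opposite sets of size m without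
   edges between them, or a small set keeping all its edges inside, would appear.
   Choosing one neighbour in B_i for each of ceil(d/2) vertices of A_i gives a
   star forest, so the constant sequence s_i = ceil(d/2) works. *)

Require Import Defs.
From mathcomp Require Import all_classical all_reals all_analysis.
From mathcomp Require Import all_boot all_order all_algebra.
From mathcomp Require Import ring lra zify.

Set Implicit Arguments.
Unset Strict Implicit.
Unset Printing Implicit Defensive.

Import Order.TTheory GRing.Theory Num.Theory.
Import numFieldNormedType.Exports.

Local Open Scope set_scope.
Local Open Scope ring_scope.

(** * The local lemma for a uniformly random function, in counting form *)

Lemma leq_card_bigcup (T I : finType) (P : pred I) (F : I -> {set T}) :
  (#|\bigcup_(i | P i) F i| <= \sum_(i | P i) #|F i|)%N.
Proof.
elim/big_ind2: _ => [|A a B b leA leB|//]; first by rewrite cards0.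
exact: leq_trans (leq_card_setU _ _).1 (leq_add leA leB).
Qed.

Section LocalLemma.
Variables T Q : finType.
Implicit Types (X : {set T}) (P S : {set {ffun T -> Q}}) (f g : {ffun T -> Q}).
Local Open Scope nat_scope.

Definition determined_on X P :=
  forall f g, {in X, f =1 g} -> (f \in P) = (g \in P).

Definition ffun_mix X f g : {ffun T -> Q} :=
  [ffun x => if x \in X then f x else g x].

(** Exchanging the values of a pair [(f, g)] outside [X] is an involution that maps [P :&: S] times
    the whole space into [P] times [S]. *)
Lemma card_independent X P S :
  determined_on X P -> determined_on (~: X) S ->
  #|P :&: S| * #|{ffun T -> Q}| <= #|P| * #|S|.
Proof.
move=> dP dS; rewrite -cardsT -!cardsX.
pose h (u : {ffun T -> Q} * {ffun T -> Q}) :=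
  (ffun_mix X u.1 u.2, ffun_mix X u.2 u.1).
have hK : involutive h.
  by move=> [f g]; congr pair; apply/ffunP=> x; rewrite !ffunE /=; do ?case: ifP.
rewrite -(card_imset _ (inv_inj hK)); apply: subset_leq_card.
apply/subsetP => _ /imsetP[[f g] /setXP[/setIP[fP fS] _] ->].
apply/setXP; split.
  by rewrite -(dP f) // => x Xx; rewrite ffunE Xx.
by rewrite -(dS f) // => x; rewrite inE ffunE => /negPf ->.
Qed.

Variables (I : finType) (bad : I -> {set {ffun T -> Q}}) (N : I -> {set T}).
Variable D : nat.
Hypothesis D_gt0 : 0 < D.
Hypothesis Q_ffun : 0 < #|{ffun T -> Q}|.
Hypothesis bad_determined : forall i, determined_on (N i) (bad i).
Hypothesis few_nbrs : forall i, #|[set j | ~~ [disjoint N i & N j]]| <= D.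
Hypothesis bad_rare : forall i, 4 * D * #|bad i| <= #|{ffun T -> Q}|.

Definition avoid (J : {set I}) : {set {ffun T -> Q}} :=
  ~: \bigcup_(i in J) bad i.

Lemma avoidP (J : {set I}) f :
  reflect (forall i, i \in J -> f \notin bad i) (f \in avoid J).
Proof.
rewrite inE; apply: (iffP idP) => [fJ i iJ | fJ].
  by apply: contra fJ => fi; apply/bigcupP; exists i.
by apply/bigcupP => -[i /fJ /negP].
Qed.

(* The conditional probability of [bad v] given [avoid J] is at most
   [1 / (2 D)]. *)
Lemma card_avoid_bad (J : {set I}) v :
  v \notin J -> 2 * D * #|avoid J :&: bad v| <= #|avoid J|.
Proof.
have [m] := ubnP #|J|; elim: m J v => // m IH J v leJm vJ.
pose J1 := [set j in J | ~~ [disjoint N v & N j]].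
pose J2 := J :\: J1.
have sJ2J : J2 \subset J by exact: subsetDl.
have leJ1 : #|J1| <= D.
  apply: leq_trans (few_nbrs v); apply: subset_leq_card.
  by apply/subsetP => j; rewrite !inE => /andP[].
have avoidS : avoid J \subset avoid J2.
  apply/subsetP => f /avoidP fJ; apply/avoidP => i iJ2.
  exact/fJ/(subsetP sJ2J).
(* The events of [J2] share no coordinate with [bad v], so avoiding them is independent of [bad v],
   whose frequency is at most [1 / (4 D)]. *)
have bad2 : 4 * D * #|avoid J2 :&: bad v| <= #|avoid J2|.
  rewrite -(leq_pmul2r Q_ffun) -mulnA (leq_trans (n := 4 * D * (#|bad v| * #|avoid J2|))) //.
    rewrite leq_mul2l; apply/orP; right; rewrite setIC.
    apply: (card_independent (@bad_determined v)) => f g fg.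
    have same i : i \in J2 -> (f \in bad i) = (g \in bad i).
      rewrite !inE negb_and negbK => /andP[/orP[/negbTE-> //|dis] _].
      apply: bad_determined => x xi; apply: fg.
      by rewrite inE (disjointFl dis xi).
    by apply/avoidP/avoidP => H i iJ2; move: (H i iJ2); rewrite same.
  by rewrite mulnA [X in _ <= X]mulnC leq_mul2r bad_rare orbT.
(* At most [D] events lie in [J1], and by induction each removes at most a fraction [1 / (2 D)] of
   [avoid J2]. So half survives, and [1 / (4 D)] becomes [1 / (2 D)]. An empty [J1] is treated apart
   because then [J2] is not smaller than [J]. *)
have half : #|avoid J2| <= 2 * #|avoid J|.
  have [J1_0|[u uJ1]] := set_0Vmem J1.
    by rewrite /J2 J1_0 setD0 leq_pmull.
  have lt_J2 : #|J2| < m.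
    rewrite ltnS in leJm; apply: leq_trans leJm; apply: proper_card.
    apply/properP; split=> //; exists u; first by move: uJ1; rewrite inE => /andP[].
    by rewrite inE uJ1.
  have lost : avoid J2 \subset
      avoid J :|: \bigcup_(w in J1) (avoid J2 :&: bad w).
    apply/subsetP => f fJ2; rewrite inE -implyNb; apply/implyP.
    rewrite inE negbK => /bigcupP[w wJ fw]; apply/bigcupP; exists w; last by rewrite inE fJ2.
    apply: contraLR fw => wJ1; move/avoidP: fJ2; apply.
    by rewrite inE wJ1.
  have := leq_trans (subset_leq_card lost) (leq_card_setU _ _).1.
  have : 2 * D * #|\bigcup_(w in J1) (avoid J2 :&: bad w)| <= D * #|avoid J2|.
    apply: (@leq_trans (2 * D * \sum_(w in J1) #|avoid J2 :&: bad w|)).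
      by rewrite leq_mul2l leq_card_bigcup orbT.
    rewrite big_distrr /= (@leq_trans (\sum_(w in J1) #|avoid J2|)) //.
      apply: leq_sum => w wJ1; apply: IH => //.
      by rewrite inE wJ1.
    by rewrite sum_nat_const leq_mul2r leJ1 orbT.
  rewrite -mulnA mulnCA leq_pmul2l //; lia.
apply: leq_trans (_ : 2 * D * #|avoid J2 :&: bad v| <= _).
  by rewrite leq_mul2l subset_leq_card ?orbT // setSI.
lia.
Qed.

(** Events are imposed one at a time. Each costs at most a fraction [1 / (2 D) <= 1 / 2] of the
    functions still available, so some function always remains. *)
Lemma lovasz_local_lemma : exists f, forall i, f \notin bad i.
Proof.
suff /card_gt0P[f /avoidP fT] : 0 < #|avoid [set: I]|.
  by exists f => i; apply: fT.
have [m] := ubnP #|[set: I]|; elim: m [set: I] => // m IH J ltJm.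
have [->|[j jJ]] := set_0Vmem J.
  by rewrite /avoid big_set0 setC0 cardsT.
have ltJ : #|J :\ j| < m by move: ltJm; rewrite (cardsD1 j J) jJ.
have := IH _ ltJ; have := @card_avoid_bad (J :\ j) j.
rewrite setD11 => /(_ isT).
have : #|avoid (J :\ j)| <= #|avoid J| + #|avoid (J :\ j) :&: bad j|.
  apply: leq_trans (leq_card_setU _ _).1; apply: subset_leq_card.
  apply/subsetP => f /avoidP fJ; rewrite inE orbC -implyNb inE.
  have -> /= : f \in avoid (J :\ j) by apply/avoidP.
  apply/implyP => fj; apply/avoidP => i iJ; have [->//|ij] := eqVneq i j.
  by apply: fJ; rewrite !inE ij.
by move: D_gt0; nia.
Qed.
End LocalLemma.

(** * Colourings rich in every colour on every neighbourhood *)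

Lemma expRN_half (R : realType) : expR (- (1 / 2)) <= 2 / 3 :> R.
Proof.
have h : 3 / 2 <= expR (1 / 2) :> R by apply: le_trans (expR_ge1Dx _); lra.
by rewrite expRN -[2 / 3]invf_div lef_pV2 // posrE ?expR_gt0.
Qed.

Lemma expRM_card (R : realType) (T : finType) (A : {set T}) (x : R) :
  expR (x * #|A|%:R) = \prod_i (if i \in A then expR x else 1).
Proof. by rewrite -big_mkcond /= prodr_const expRM_natr. Qed.

(** Exponential Markov inequality with weight [expR (- (1 / 2))] per point of [N] coloured [j]. The
    sum over colourings factors over points, and a point of [N] contributes on average at most
    [1 - 1 / (3 (d + 1))], because [expR (- (1 / 2)) <= 2 / 3]. *)
Lemma card_scarce_colorings (R : realType) (T : finType) (d : nat) (N : {set T})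
    (j : 'I_d.+1) (t : R) :
  #|[set f : {ffun T -> 'I_d.+1} | #|[set x in N | f x == j]|%:R < t]|%:R
  <= expR (t / 2 - #|N|%:R / (3 * d.+1%:R)) * #|{ffun T -> 'I_d.+1}|%:R.
Proof.
pose z : R := expR (- (1 / 2)).
pose w x (c : 'I_d.+1) : R := if (x \in N) && (c == j) then z else 1.
have wE (f : {ffun T -> 'I_d.+1}) :
    \prod_x w x (f x) = expR (- (1 / 2) * #|[set x in N | f x == j]|%:R).
  rewrite expRM_card; apply: eq_bigr => x _.
  by rewrite /w /= [in RHS]inE.
rewrite -sum1_card natr_sum.
apply: (@le_trans _ _ (\sum_(f : {ffun T -> 'I_d.+1})
   expR (t / 2) * \prod_x w x (f x))).
  rewrite big_mkcond /=; apply: ler_sum => f _; rewrite inE wE -expRD.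
  case: ifP => [lt_t|_]; last exact: expR_ge0.
  rewrite -[leLHS]expR0 ler_expR; lra.
rewrite -big_distrr /= -(bigA_distr_bigA w) /= expRD -mulrA ler_wpM2l ?expR_ge0 //.
have k_gt0 : 0 < d.+1%:R :> R by rewrite ltr0n.
have -> : - (#|N|%:R / (3 * d.+1%:R)) = (- (3 * d.+1%:R)^-1) * #|N|%:R :> R.
  by rewrite mulNr mulrC.
rewrite expRM_card card_ffun card_ord natrX -prodr_const -big_split /=.
apply: ler_prod => x _; apply/andP; split.
  by apply: sumr_ge0 => c _; rewrite /w; case: ifP => // _; exact: expR_ge0.
rewrite /w; case: ifP => xN /=; last by rewrite sumr_const card_ord mul1r.
rewrite (bigD1 j) //= eqxx (eq_bigr (fun=> 1)); last by move=> c /negPf->.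
rewrite sumr_const cardC1 card_ord /=.
apply: (@le_trans _ _ ((1 - (3 * d.+1%:R)^-1) * d.+1%:R)); last first.
  by rewrite ler_wpM2r ?ler0n // expR_ge1Dx.
rewrite mulrBl mul1r invfM -mulrA mulVf ?gt_eqF // mulr1 -natr1.
have := expRN_half R; rewrite -/z; lra.
Qed.

(** Local lemma for the events that some colour occurs fewer than [t] times in [N i]. The factor
    [d.+1] in the condition is the union bound over colours. *)
Lemma polychromatic_coloring (R : realType) (T I : finType) (N : I -> {set T})
    (d D : nat) (a t : R) :
  (0 < D)%N ->
  (forall i, #|[set j | ~~ [disjoint N i & N j]]| <= D)%N ->
  (forall i, a <= #|N i|%:R) ->
  4 * D%:R * d.+1%:R * expR (t / 2 - a / (3 * d.+1%:R)) <= 1 ->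
  exists f : {ffun T -> 'I_d.+1},
    forall i j, t <= #|[set x in N i | f x == j]|%:R.
Proof.
move=> D0 few aN small.
pose bad i := [set f : {ffun T -> 'I_d.+1} |
  [exists j, #|[set x in N i | f x == j]|%:R < t]].
have k_gt0 : 0 < d.+1%:R :> R by rewrite ltr0n.
have [|i f g fg|i|f fP] := @lovasz_local_lemma _ _ _ bad N D D0 _ _ few.
- by rewrite card_ffun card_ord expn_gt0.
- rewrite !inE; apply: eq_existsb => j; congr (_%:R < _); apply: eq_card => x.
  by rewrite !inE; case: (boolP (x \in N i)) => //= xN; rewrite fg.
- rewrite -(ler_nat R) natrM.
  set M := #|{ffun _ -> _}|.
  have M0 : 0 <= M%:R :> R by rewrite ler0n.
  apply: (@le_trans _ _ ((4 * D%:R * d.+1%:R * expR (t / 2 - a / (3 * d.+1%:R))) * M%:R)); last first.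
    by rewrite ler_piMl.
  rewrite natrM -!mulrA !ler_wpM2l ?ler0n //.
  apply: (@le_trans _ _ (\sum_(j : 'I_d.+1)
     #|[set f : {ffun T -> 'I_d.+1} | #|[set x in N i | f x == j]|%:R < t]|%:R)).
    rewrite -natr_sum ler_nat; apply: leq_trans (leq_card_bigcup _ _).
    apply: subset_leq_card; apply/subsetP => f; rewrite inE => /existsP[j ltj].
    by apply/bigcupP; exists j => //; rewrite inE.
  rewrite mulr_natl -[X in _ *+ X]card_ord -sumr_const; apply: ler_sum => j _.
  apply: le_trans (card_scarce_colorings _ _ _) _.
  rewrite ler_wpM2r // ler_expR lerD2l lerN2 ler_wpM2r // invr_ge0.
exists f => i j; have := fP i; rewrite inE negb_exists => /forallP/(_ j).
by rewrite -leNgt.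
Qed.

(** * Union bound and Chernoff bound in the random bipartite graph *)

Section GnnpProbability.
Variables (R : realType) (n : nat) (p : R).
Hypothesis p01 : 0 <= p <= 1.
Local Notation graph := {set 'I_n * 'I_n}.
Implicit Types (E F : graph) (P : graph -> Prop).

Lemma Gnnp_weight_ge0 E : 0 <= Gnnp_weight p E.
Proof.
by apply: prodr_ge0 => e _; case/andP: p01 => p0 p1; case: ifP; rewrite ?subr_ge0.
Qed.

Lemma Gnnp_prob_le P P' :
  (forall E, P E -> P' E) -> Gnnp_prob p P <= Gnnp_prob p P'.
Proof.
move=> PP'; rewrite /Gnnp_prob big_mkcond [leRHS]big_mkcond /=.
apply: ler_sum => E _; case: asboolP => [/PP' PE|_]; first by rewrite asboolT.
by case: ifP => // _; exact: Gnnp_weight_ge0.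
Qed.

Lemma Gnnp_probC P : Gnnp_prob p (fun E => ~ P E) = 1 - Gnnp_prob p P.
Proof.
rewrite -(Gnnp_weight_sum1 n p) /Gnnp_prob (bigID (fun E => `[< P E >]) xpredT) /=.
rewrite [X in _ = X - _]addrC addrK.
by apply: eq_bigl => E; rewrite asbool_neg.
Qed.

Lemma Gnnp_prob_exists (J : finType) (S : pred J) (P : J -> graph -> Prop) :
  Gnnp_prob p (fun E => exists2 j, S j & P j E)
  <= \sum_(j | S j) Gnnp_prob p (P j).
Proof.
rewrite /Gnnp_prob (exchange_big_dep xpredT) //= big_mkcond /=.
apply: ler_sum => E _; case: asboolP => [[j Sj Pj]|_]; last first.
  by apply: sumr_ge0 => j _; exact: Gnnp_weight_ge0.
rewrite (bigD1 j) /=; last by rewrite Sj asboolT.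
by rewrite lerDl; apply: sumr_ge0 => i _; exact: Gnnp_weight_ge0.
Qed.

Lemma Gnnp_prob_or P P' :
  Gnnp_prob p (fun E => P E \/ P' E) <= Gnnp_prob p P + Gnnp_prob p P'.
Proof.
rewrite /Gnnp_prob big_mkcond [X in _ <= X + _]big_mkcond.
rewrite [X in _ <= _ + X]big_mkcond -big_split /=.
apply: ler_sum => E _; have w0 := Gnnp_weight_ge0 E.
case: asboolP => [|_]; last by rewrite addr_ge0 //; case: ifP.
by case=> h; rewrite (asboolT h) ?lerDl ?lerDr; case: ifP.
Qed.

(* Chernoff: [lam > 0] gives the upper tail and [lam < 0] the lower tail. *)
Lemma Gnnp_tail F (lam tau : R) :
  Gnnp_prob p (fun E => lam * tau <= lam * #|E :&: F|%:R)
  <= expR (p * #|F|%:R * (expR lam - 1) - lam * tau).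
Proof.
have [p0 p1] := andP p01.
pose g e : R := p * (if e \in F then expR lam else 1).
have wE E : Gnnp_weight p E * expR (lam * #|E :&: F|%:R)
    = \prod_e (if e \in E then g e else 1 - p).
  rewrite expRM_card -big_split /=; apply: eq_bigr => e _.
  rewrite inE /g; case: ifP => //= _; exact: mulr1.
apply: (@le_trans _ _ (\sum_E expR (- (lam * tau)) *
    (Gnnp_weight p E * expR (lam * #|E :&: F|%:R)))).
  rewrite /Gnnp_prob big_mkcond /=; apply: ler_sum => E _.
  have w0 := Gnnp_weight_ge0 E.
  case: asboolP => [le_tau|_]; last by rewrite !mulr_ge0 ?expR_ge0.
  rewrite mulrCA -expRD ler_peMr // -[leLHS]expR0 ler_expR; lra.
rewrite -big_distrr /= addrC expRD ler_wpM2l ?expR_ge0 //.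
(* The sum over edge sets factors over pairs; a pair of [F] contributes [1 + p (expR lam - 1)],
   which is bounded by [1 + x <= expR x]. *)
rewrite (eq_bigr _ (fun E _ => wE E)) -(bigA_distr _ _ g (fun=> 1 - p)) /=.
rewrite mulrAC expRM_card; apply: ler_prod => e _; rewrite /g /=.
case: ifP => _; last by rewrite mulr1 addrCA subrr addr0 ler01 lexx.
rewrite addr_ge0 ?mulr_ge0 ?expR_ge0 ?subr_ge0 //=.
apply: le_trans _ (expR_ge1Dx _); lra.
Qed.

End GnnpProbability.

(** * Sets of prescribed size and double counting *)

Lemma exists_subset_card (T : finType) (X : {set T}) (k : nat) :
  (k <= #|X|)%N -> exists2 Y : {set T}, Y \subset X & #|Y| = k.
Proof.
case/card_geqP=> s [us ss sX]; exists [set x in s].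
  by apply/subsetP => x; rewrite inE => /sX.
by rewrite cardsE (card_uniqP us).
Qed.

Lemma exists_superset_card (T : finType) (X : {set T}) (k : nat) :
  (#|X| <= k <= #|T|)%N -> exists2 Y : {set T}, X \subset Y & #|Y| = k.
Proof.
case/andP=> leXk lekT; have [|Y sY cY] := @exists_subset_card _ (~: X) (k - #|X|)%N.
  by have := cardsC X; lia.
exists (X :|: Y); first exact: subsetUl.
rewrite cardsU (_ : X :&: Y = set0) ?cards0 ?cY; first by lia.
by apply/eqP; rewrite setI_eq0 disjoint_sym -[X]setCK -subsets_disjoint.
Qed.

Section BipartiteCounting.
Variables (A B : finType) (E : {set A * B}).
Implicit Types (X : {set A}) (Y : {set B}).
Local Open Scope nat_scope.

Lemma card_edgesA X Y :
  #|E :&: setX X Y| = \sum_(a in X) #|[set b in Y | (a, b) \in E]|.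
Proof.
rewrite (eq_bigr _ (fun a _ => esym (sum1_card _))) pair_big_dep -sum1_card /=; apply: eq_bigl => -[a b].
rewrite !inE /=; do ?case: (_ \in _) => //.
Qed.

Lemma card_edgesB X Y :
  #|E :&: setX X Y| = \sum_(b in Y) #|[set a in X | (a, b) \in E]|.
Proof.
rewrite (eq_bigr _ (fun b _ => esym (sum1_card _))).
rewrite (exchange_big_dep (mem X)) /=; last by move=> b a _; rewrite inE => /andP[].
rewrite card_edgesA; apply: eq_bigr => a aX; rewrite -sum1_card.
by apply: eq_bigl => b; rewrite !inE aX.
Qed.

End BipartiteCounting.

(** Bounds the dependency degree for the local lemma: each of the at most [D] points of [N i] lies
    in at most [D] of the sets. *)
Lemma card_meeting_sets (I T : finType) (N : I -> {set T}) (D : nat) (i : I) :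
  (forall i, #|N i| <= D)%N -> (forall x, #|[set i | x \in N i]| <= D)%N ->
  (#|[set j | ~~ [disjoint N i & N j]]| <= D * D)%N.
Proof.
move=> degI degT.
apply: (@leq_trans #|\bigcup_(x in N i) [set j | x \in N j]|).
  apply: subset_leq_card; apply/subsetP => j; rewrite inE -setI_eq0.
  case/set0Pn=> x; rewrite inE => /andP[xi xj].
  by apply/bigcupP; exists x; rewrite ?inE.
apply: leq_trans (leq_card_bigcup _ _) _.
apply: (@leq_trans (\sum_(x in N i) D)); first by apply: leq_sum => x _.
by rewrite sum_nat_const leq_mul2r degI orbT.
Qed.

(** The pairs [(i, x)] with [x] in [N i] of colour [j] number at least [t] per index and at most [M]
    per point of the class. *)
Lemma color_class_large (R : realType) (I T C : finType) (N : I -> {set T})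
    (g : T -> C) (j : C) (t M : R) :
  (forall i, t <= #|[set x in N i | g x == j]|%:R) ->
  (forall x, #|[set i | x \in N i]|%:R <= M) ->
  #|I|%:R * t <= #|[set x | g x == j]|%:R * M.
Proof.
move=> many deg; pose E := [set e : I * T | e.2 \in N e.1].
apply: (@le_trans _ _ #|E :&: setX [set: I] [set x | g x == j]|%:R).
  rewrite card_edgesA natr_sum mulr_natl -cardsT -sumr_const.
  apply: ler_sum => i _; rewrite (le_trans (many i)) // ler_nat.
  by apply/subset_leq_card/subsetP => x; rewrite !inE andbC.
rewrite card_edgesB natr_sum mulr_natl -sumr_const.
apply: ler_sum => x _; rewrite (le_trans _ (deg x)) // ler_nat.
by apply/subset_leq_card/subsetP => i; rewrite !inE.
Qed.

(** * Rigid partitions from colourings of a pseudorandom graph *)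

(** A cycle of length at least 3 visits some vertex of [A], which has two distinct neighbours on it;
    here vertices of [A] have degree at most one. *)
Lemma star_forest (A B : finType) (F : {set A * B}) :
  (forall a b b', (a, b) \in F -> (a, b') \in F -> b = b') -> is_forest F.
Proof.
move=> funF [|x [|y [|z c]]] //; rewrite /ucycle /= => /andP[].
case/and3P=> xy yz zc /andP[]; rewrite !inE !negb_or => /and3P[_ xz _] /andP[/andP[_ yc] _].
case: x y xy yz zc xz yc => [a|b] [a'|b'] //=; case: z => [a''|b''] //=.
  move=> ab' a''b' pc _ yc; exfalso; move: pc yc; case: c => //= -[//|b] c /andP[zb _].
  by rewrite (funF _ _ _ zb a''b') inE eqxx.
by move=> a'b a'b'' _; rewrite (funF _ _ _ a'b a'b'') eqxx.
Qed.

Section Rigidity.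
Variables (R : realType) (A B : finType) (E : {set A * B}) (d m : nat) (t : R).
Variables (f : A -> 'I_d.+1) (g : B -> 'I_d.+1).
Implicit Types (X : {set A}) (Y : {set B}).
Hypothesis t_gt0 : 0 < t.
Hypothesis m_gt0 : (0 < m)%N.
Hypothesis nbrsA : forall a j,
  t <= #|[set b in [set b | (a, b) \in E] | g b == j]|%:R.
Hypothesis nbrsB : forall b i,
  t <= #|[set a in [set a | (a, b) \in E] | f a == i]|%:R.
Hypothesis sizeA : forall i, (2 * m <= #|[set a | f a == i]|)%N.
Hypothesis sizeB : forall j, (2 * m <= #|[set b | g b == j]|)%N.
Hypothesis joined : forall X Y,
  (m <= #|X|)%N -> (m <= #|Y|)%N -> E :&: setX X Y != set0.
Hypothesis sparse : forall X Y x, (0 < x <= m)%N -> (#|X| <= x)%N ->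
  (#|Y| <= x)%N -> #|E :&: setX X Y|%:R < t * x%:R.
Hypothesis sizeF : forall i, (uphalf d <= #|[set a | f a == i]|)%N.

(* If the larger of [X] and [Y] had size [x < m], then by closedness it would
   send at least [t x] edges into the other one, against [sparse]. *)
Lemma closed_pair_large i j X Y :
  (forall a b, a \in X -> (a, b) \in E -> g b = j -> b \in Y) ->
  (forall a b, b \in Y -> (a, b) \in E -> f a = i -> a \in X) ->
  (0 < #|X| + #|Y|)%N -> (m <= #|X|)%N || (m <= #|Y|)%N.
Proof.
move=> clX clY ne; apply/negPn; rewrite negb_or -!ltnNge.
apply/negP => /andP[ltX ltY].
have [leYX|/ltnW leXY] := leqP #|Y| #|X|.
  have x0 : (0 < #|X| <= m)%N by lia.
  have := sparse x0 (leqnn _) leYX; apply/negP; rewrite -leNgt.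
  rewrite card_edgesA natr_sum mulr_natr -sumr_const; apply: ler_sum => a aX.
  apply: le_trans (nbrsA a j) _; rewrite ler_nat.
  apply/subset_leq_card/subsetP => b; rewrite !inE => /andP[ab /eqP gb].
  by rewrite ab (clX a).
have x0 : (0 < #|Y| <= m)%N by lia.
have := sparse x0 leXY (leqnn _); apply/negP; rewrite -leNgt.
rewrite card_edgesB natr_sum mulr_natr -sumr_const; apply: ler_sum => b bY.
apply: le_trans (nbrsB b i) _; rewrite ler_nat.
apply/subset_leq_card/subsetP => a; rewrite !inE => /andP[ab /eqP fa].
by rewrite ab (clY a b).
Qed.

Definition color_class i : {set A + B} :=
  [set u | match u with inl a => f a == i | inr b => g b == i end].

Lemma class_partA i a : (inl a \in color_class i :&: partA A B) = (f a == i).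
Proof. by rewrite !inE; apply/andb_idr => _; apply/imsetP; exists a. Qed.

Lemma class_partB j b : (inr b \in color_class j :&: partB A B) = (g b == j).
Proof. by rewrite !inE; apply/andb_idr => _; apply/imsetP; exists b. Qed.

Lemma class_partA_r i b : (inr b \in color_class i :&: partA A B) = false.
Proof. by rewrite inE andbC; apply/negP => /andP[/imsetP[]]. Qed.

Lemma class_partB_l j a : (inl a \in color_class j :&: partB A B) = false.
Proof. by rewrite inE andbC; apply/negP => /andP[/imsetP[]]. Qed.

Let classE := (class_partA, class_partB, class_partA_r, class_partB_l).

(** If [v] is not reachable from [u], the reachable vertices [X true], [Y true] and the remaining
    ones [X false], [Y false] form two nonempty pairs, each closed under taking neighbours in the
    two classes. *)
Lemma classes_connected i j :
  connected_between E (color_class i :&: partA A B) (color_class j :&: partB A B).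
Proof.
pose e := adj (edges_between E (color_class i :&: partA A B)
  (color_class j :&: partB A B)).
split.
  have /card_gt0P[a] : (0 < #|[set a | f a == i]|)%N by have := sizeA i; lia.
  by rewrite inE => fa; apply/set0Pn; exists (inl a); rewrite inE classE fa.
have eAB a b : f a = i -> g b = j -> (a, b) \in E ->
    e (inl a) (inr b) /\ e (inr b) (inl a).
  by move=> fa gb ab; rewrite /e /= inE /= ab !classE fa gb !eqxx.
move=> u v uU vU; rewrite -/e; apply/negPn/negP => uv.
pose X c := [set a | (f a == i) && (connect e u (inl a) == c)].
pose Y c := [set b | (g b == j) && (connect e u (inr b) == c)].
have clX c a b : a \in X c -> (a, b) \in E -> g b = j -> b \in Y c.
  rewrite !inE => /andP[/eqP fa /eqP <-] ab gb; rewrite gb eqxx /=.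
  have [h1 h2] := eAB _ _ fa gb ab; apply/eqP; apply/idP/idP => h.
    exact: connect_trans h (connect1 h2).
  exact: connect_trans h (connect1 h1).
have clY c a b : b \in Y c -> (a, b) \in E -> f a = i -> a \in X c.
  rewrite !inE => /andP[/eqP gb /eqP <-] ab fa; rewrite fa eqxx /=.
  have [h1 h2] := eAB _ _ fa gb ab; apply/eqP; apply/idP/idP => h.
    exact: connect_trans h (connect1 h1).
  exact: connect_trans h (connect1 h2).
have XY w c : w \in (color_class i :&: partA A B) :|: (color_class j :&: partB A B) ->
    connect e u w = c -> (0 < #|X c| + #|Y c|)%N.
  rewrite inE; case: w => [a|b]; rewrite !classE ?orbF /= => h <-.
    by rewrite addn_gt0; apply/orP; left; apply/card_gt0P; exists a; rewrite inE h eqxx.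
  by rewrite addn_gt0; apply/orP; right; apply/card_gt0P; exists b; rewrite inE h eqxx.
have sumX : #|[set a | f a == i]| = (#|X true| + #|X false|)%N.
  rewrite -(cardsID [set a | connect e u (inl a)]).
  by congr addn; apply: eq_card => a; rewrite !inE; case: connect; rewrite ?andbT ?andbF.
have sumY : #|[set b | g b == j]| = (#|Y true| + #|Y false|)%N.
  rewrite -(cardsID [set b | connect e u (inr b)]).
  by congr addn; apply: eq_card => b; rewrite !inE; case: connect; rewrite ?andbT ?andbF.
(* Otherwise [joined] gives an edge from a reachable vertex to an unreachable one. *)
have apart c : ~~ ((m <= #|X c|)%N && (m <= #|Y (~~ c)|)%N).
  apply/negP => /andP[leX leY]; have := joined leX leY.
  case/set0Pn=> -[a b]; rewrite !inE /= => /and3P[ab /andP[fa /eqP ac] /andP[/eqP gb /eqP bc]].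
  have aX : a \in X c by rewrite inE fa ac eqxx.
  by have := clX _ _ _ aX ab gb; rewrite inE bc gb eqxx /=; case: (c).
(* Some [X c] has at least [m] vertices, as its class has [2 m]. Then [Y (~~ c)] is smaller than
   [m], so [X (~~ c)] is large because its pair is closed, so [Y c] is small too. The class in [B]
   then has fewer than [2 m] vertices, a contradiction. *)
have := closed_pair_large (clX true) (clY true) (XY u _ uU (connect0 _ _)).
have := closed_pair_large (clX false) (clY false) (XY v _ vU (negbTE uv)).
have := sizeA i; have := sizeB j; have := apart true; have := apart false.
rewrite sumX sumY /=; lia.
Qed.

Lemma rigid_of_colorings : admits_strong_bipartite_rigid_partition E d.
Proof.
exists color_class; split.
- split.
  + move=> i; have /card_gt0P[a] : (0 < #|[set a | f a == i]|)%N by have := sizeA i; lia.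
    by rewrite inE => fa; apply/set0Pn; exists (inl a); rewrite inE.
  + move=> i j ij; rewrite -setI_eq0; apply/eqP/setP => u; rewrite !inE.
    by apply/negP; case: u => [a|b] /andP[/eqP-> /eqP]; apply/eqP.
  + by case=> [a|b]; [exists (f a)|exists (g b)]; rewrite inE.
- by move=> i j _; exact: classes_connected.
(* For [k <= d + 1], [k] terms sum to at least [k d / 2 >= k (k - 1) / 2]. *)
exists (fun=> uphalf d); split=> //.
- move=> k /andP[k0 kd].
  rewrite -(big_ord_widen _ (fun=> uphalf d) kd) sum_nat_const card_ord bin2.
  by have := odd_double_half (k * k.-1); have := odd_double_half d.+1; rewrite -uphalfE; nia.
move=> i.
have [X sX cX] := exists_subset_card (sizeF i).
have nb a : exists b, ((a, b) \in E) && (g b == i).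
  have : 0 < #|[set b in [set b | (a, b) \in E] | g b == i]|%:R :> R.
    exact: lt_le_trans (nbrsA a i).
  by rewrite ltr0n => /card_gt0P[b]; rewrite !inE => h; exists b.
pose h a := xchoose (nb a).
exists [set (a, h a) | a in X]; split.
- apply/subsetP => _ /imsetP[a aX ->]; have /andP[ah gh] := xchooseP (nb a).
  rewrite inE ah /= !classE gh andbT; apply/orP; left.
  by move/subsetP: sX => /(_ _ aX); rewrite inE.
- by apply: star_forest => a b b' /imsetP[? _ [-> ->]] /imsetP[? _ [-> ->]].
- by rewrite card_imset // => a a' [].
Qed.

End Rigidity.

(** * Probabilities of the bad events *)

(** This is the bound [(e n / x)^x]: with [z = x / n], the single term ['C(n, x) z^x] of [(1 + z)^n]
    is at most [expR (n z) = expR x]. *)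
Lemma bin_le_expR (R : realType) (n x : nat) : (0 < n)%N -> (0 < x)%N ->
  'C(n, x)%:R <= expR (x%:R * (1 + ln (n%:R / x%:R))) :> R.
Proof.
move=> n0 x0; have [ltnx|lexn] := ltnP n x; first by rewrite bin_small ?expR_ge0.
have n0R : 0 < n%:R :> R by rewrite ltr0n.
have x0R : 0 < x%:R :> R by rewrite ltr0n.
pose z : R := x%:R / n%:R.
have z0 : 0 < z by rewrite divr_gt0.
rewrite mulrDr mulr1 expRD expRM_natl lnK ?posrE ?divr_gt0 //.
rewrite -invf_div -/z exprVn ler_pdivlMr ?exprn_gt0 //.
apply: (@le_trans _ _ ((1 + z) ^+ n)).
  rewrite exprDn (bigD1 (inord x)) //= inordK ?ltnS // expr1n mul1r mulr_natl lerDl.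
  by apply: sumr_ge0 => i _; rewrite expr1n mul1r mulrn_wge0 // exprn_ge0 // ltW.
rewrite (_ : x%:R = n%:R * z); last by rewrite /z mulrCA divff ?mulr1 // gt_eqF.
by rewrite expRM_natl; apply: lerXn2r; rewrite ?nnegrE ?expR_ge0 ?expR_ge1Dx // addr_ge0 // ltW.
Qed.

Section GnnpEvents.
Variables (R : realType) (n : nat) (p : R).
Hypothesis p01 : 0 <= p <= 1.
Local Notation graph := {set 'I_n * 'I_n}.
Implicit Types (E : graph) (X Y : {set 'I_n}).

Lemma Gnnp_prob_pairs (x : nat) (P : {set 'I_n} -> {set 'I_n} -> graph -> Prop) (b : R) :
  (forall X Y, #|X| = x -> #|Y| = x -> Gnnp_prob p (P X Y) <= b) ->
  Gnnp_prob p (fun E => exists X Y, [/\ #|X| = x, #|Y| = x & P X Y E])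
  <= 'C(n, x)%:R ^+ 2 * b.
Proof.
move=> Pb.
apply: (@le_trans _ _ (Gnnp_prob p (fun E =>
    exists2 u : {set 'I_n} * {set 'I_n}, (#|u.1| == x) && (#|u.2| == x) & P u.1 u.2 E))).
  by apply: Gnnp_prob_le => // E [X [Y [/eqP cX /eqP cY PE]]]; exists (X, Y); rewrite ?cX ?cY.
apply: le_trans (Gnnp_prob_exists p01 _ _) _.
apply: (@le_trans _ _ (\sum_(u : {set 'I_n} * {set 'I_n} | (#|u.1| == x) && (#|u.2| == x)) b)).
  by apply: ler_sum => u /andP[/eqP c1 /eqP c2]; exact: Pb.
rewrite sumr_const -[leLHS]mulr_natl.
rewrite (_ : #|_| = #|setX [set X : {set 'I_n} | #|X| == x] [set X : {set 'I_n} | #|X| == x]|); last first.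
  by apply: eq_card => u; rewrite !inE.
by rewrite cardsX card_draws card_ord natrM expr2.
Qed.

Lemma Gnnp_unjoined (x : nat) :
  Gnnp_prob p (fun E => exists X Y, [/\ #|X| = x, #|Y| = x & E :&: setX X Y = set0])
  <= 'C(n, x)%:R ^+ 2 * expR (- (p * x%:R ^+ 2 / 2)).
Proof.
apply: Gnnp_prob_pairs => X Y cX cY.
(* Chernoff with [lam = -1] and [tau = 0]; since [expR (-1) <= 1 / 2], the exponent is at most
   [- p x^2 / 2]. *)
apply: le_trans (_ : Gnnp_prob p (fun E => -1 * 0 <= -1 * #|E :&: setX X Y|%:R) <= _).
  by apply: Gnnp_prob_le => // E ->; rewrite cards0.
apply: le_trans (Gnnp_tail p01 _ _ _) _; rewrite ler_expR cardsX cX cY natrM.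
have e1 : expR (-1) <= 1 / 2 :> R.
  rewrite (_ : -1 = - (1 / 2) + - (1 / 2)) ?expRD; last by lra.
  have := expRN_half R; have := expR_ge0 (- (1 / 2) : R); nra.
have [p0 _] := andP p01.
have : 0 <= p * x%:R ^+ 2 by rewrite mulr_ge0 ?exprn_ge0.
nra.
Qed.

Lemma Gnnp_dense (x : nat) (s lam : R) : 0 < lam ->
  Gnnp_prob p (fun E => exists X Y,
    [/\ #|X| = x, #|Y| = x & s * x%:R <= #|E :&: setX X Y|%:R])
  <= 'C(n, x)%:R ^+ 2 * expR (p * x%:R ^+ 2 * (expR lam - 1) - lam * (s * x%:R)).
Proof.
move=> lam0; apply: Gnnp_prob_pairs => X Y cX cY.
apply: le_trans (_ : Gnnp_prob p (fun E => lam * (s * x%:R) <= lam * #|E :&: setX X Y|%:R) <= _).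
  by apply: Gnnp_prob_le => // E h; rewrite ler_wpM2l // ltW.
apply: le_trans (Gnnp_tail p01 _ _ _) _.
by rewrite cardsX cX cY natrM -expr2.
Qed.

Definition degrees_between (a b : R) E :=
  (forall v, a <= #|[set w | (v, w) \in E]|%:R <= b) /\
  (forall w, a <= #|[set v | (v, w) \in E]|%:R <= b).

(** The factor [4 n] counts [2 n] vertices with two tails each; [y] and [z] are the Chernoff
    parameters of the lower and the upper tail. A degree counts the edges in a row or column of [n]
    pairs. *)
Lemma Gnnp_degrees (a b y z beta : R) : 0 < y -> 0 < z ->
  expR (n%:R * p * (expR (- y) - 1) + y * a) <= beta ->
  expR (n%:R * p * (expR z - 1) - z * b) <= beta ->
  Gnnp_prob p (fun E => ~ degrees_between a b E) <= 4 * n%:R * beta.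
Proof.
move=> y0 z0 low high.
have tail (F : graph) : #|F| = n ->
    Gnnp_prob p (fun E => ~ (a <= #|E :&: F|%:R <= b)) <= 2 * beta.
  move=> cF; apply: (@le_trans _ _ (Gnnp_prob p (fun E =>
      - y * a <= - y * #|E :&: F|%:R \/ z * b <= z * #|E :&: F|%:R))).
    apply: Gnnp_prob_le => // E /negP; rewrite negb_and -!ltNge => /orP[/ltW h|/ltW h].
      by left; rewrite !mulNr lerN2 ler_wpM2l // ltW.
    by right; rewrite ler_wpM2l // ltW.
  apply: le_trans (Gnnp_prob_or p01 _ _) _; rewrite mulr_natl mulr2n; apply: lerD.
    apply: le_trans (Gnnp_tail p01 _ _ _) _; apply: le_trans low.
    by rewrite cF mulNr opprK [p * _]mulrC.
  apply: le_trans (Gnnp_tail p01 _ _ _) _; apply: le_trans high.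
  by rewrite cF [p * _]mulrC.
have rowE (E : graph) v : #|[set w | (v, w) \in E]| = #|E :&: setX [set v] [set: 'I_n]|.
  by rewrite card_edgesA big_set1; apply: eq_card => w; rewrite !inE.
have colE (E : graph) w : #|[set v | (v, w) \in E]| = #|E :&: setX [set: 'I_n] [set w]|.
  by rewrite card_edgesB big_set1; apply: eq_card => v; rewrite !inE.
apply: (@le_trans _ _ (Gnnp_prob p (fun E =>
    (exists2 v : 'I_n, xpredT v & ~ (a <= #|E :&: setX [set v] [set: 'I_n]|%:R <= b)) \/
    (exists2 w : 'I_n, xpredT w & ~ (a <= #|E :&: setX [set: 'I_n] [set w]|%:R <= b))))).
  apply: Gnnp_prob_le => // E bad; apply: contrapT => /not_orP[h1 h2]; apply: bad.
  split=> v; apply: contrapT => h.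
    by apply: h1; exists v => //; rewrite -rowE.
  by apply: h2; exists v => //; rewrite -colE.
have sum_tail (F : 'I_n -> graph) : (forall v, #|F v| = n) ->
    Gnnp_prob p (fun E => exists2 v : 'I_n, xpredT v & ~ (a <= #|E :&: F v|%:R <= b))
    <= 2 * n%:R * beta.
  move=> cF; apply: le_trans (Gnnp_prob_exists p01 _ _) _.
  apply: (@le_trans _ _ (\sum_(v < n) 2 * beta)); first by apply: ler_sum => v _; exact: tail.
  by rewrite sumr_const card_ord -mulrnAl -mulr_natr.
apply: le_trans (Gnnp_prob_or p01 _ _) _.
rewrite (_ : 4 * n%:R * beta = 2 * n%:R * beta + 2 * n%:R * beta); last by ring.
by apply: lerD; apply: sum_tail => v; rewrite cardsX cards1 cardsT card_ord ?mul1n ?muln1.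
Qed.

End GnnpEvents.

(** * Pseudorandomness at the scale [m] and its consequences *)

Lemma geometric_sum_le (R : realType) (r : R) (k : nat) : 0 <= r <= 1 / 2 ->
  \sum_(x < k) r ^+ x.+1 <= 2 * r.
Proof.
case/andP=> r0 r1; suff : \sum_(x < k) r ^+ x.+1 <= 2 * r - 2 * r ^+ k.+1.
  by move/le_trans; apply; rewrite gerBl mulr_ge0 ?exprn_ge0.
elim: k => [|k IH]; first by rewrite big_ord0 expr1 subrr.
rewrite big_ord_recr /=; have := exprn_ge0 k.+1 r0.
by rewrite [r ^+ k.+2]exprS; nra.
Qed.

Section PseudorandomGraph.
Variables (R : realType) (n : nat) (p delta C c : R) (d : nat).
Hypothesis p01 : 0 <= p <= 1.
Hypothesis delta01 : 0 < delta <= 1.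
Hypothesis C16 : 1 <= C <= 6.
Hypothesis c_gt0 : 0 < c.
Hypothesis c_small : 576 * expR 2 * c <= delta.
Local Notation q := (n%:R * p).
Local Notation L := (ln q).
Local Notation K := (d.+1%:R : R).
(* The scale at which any two vertex sets span an edge. *)
Local Notation m := (Num.truncn (6 * L / p)).+1.
Hypothesis L_ge2 : 2 <= L.
Hypothesis q_large : 4 * C ^+ 2 <= q.
Hypothesis d_small : K <= 2 * c * q / L.
Hypothesis d_sqrt : K ^+ 2 * C <= n%:R * delta.

Let q_gt0 : 0 < q.
Proof. by rewrite ltNge; apply/negP => /(@ln0 R) L0; move: L_ge2; rewrite L0; lra. Qed.

Let p_gt0 : 0 < p.
Proof.
have [p0 _] := andP p01; rewrite lt_neqAle p0 andbT; apply/eqP => p_0.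
by move: q_gt0; rewrite -p_0 mulr0 ltxx.
Qed.

Let n_gt0 : 0 < n%:R :> R.
Proof. by rewrite -(pmulr_lgt0 _ p_gt0). Qed.

Let K_gt0 : 0 < K.
Proof. by rewrite ltr0n. Qed.

Let L_gt0 : 0 < L.
Proof. by apply: lt_le_trans L_ge2. Qed.

Let expRL : expR L = q.
Proof. by rewrite lnK // posrE. Qed.

Let expR2_ge1 : 1 <= expR 2 :> R.
Proof. by apply: le_trans _ (expR_ge1Dx _); lra. Qed.

Let c_le : 576 * c <= delta.
Proof. by move: c_small expR2_ge1 c_gt0; nra. Qed.

Let KL_le : K * L <= 2 * c * q.
Proof. by rewrite -ler_pdivlMr. Qed.

Let K_le_q : K <= q.
Proof.
have [_ d1] := andP delta01.
have : K * 2 <= K * L by rewrite ler_pM2l.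
have : c * q <= 1 * q by rewrite ler_pM2r //; move: c_le c_gt0; lra.
by move: KL_le; lra.
Qed.

Let pm_ge : 6 * L <= p * m%:R.
Proof.
rewrite [p * _]mulrC -ler_pdivrMr //; apply/ltW; exact: truncnS_gt.
Qed.

Let pm_le : p * m%:R <= 12 * L.
Proof.
have h : (Num.truncn (6 * L / p))%:R <= 6 * L / p.
  by rewrite truncn_le divr_ge0 // ltW // mulr_gt0.
move: h; rewrite ler_pdivlMr // => h.
have [_ p1] := andP p01; rewrite -natr1 mulrDr mulr1.
by move: L_ge2; lra.
Qed.

(** As [p m >= 6 L] and [n / m <= q], the exponent is at most
    [m (2 + 2 L - 3 L) = m (2 - L) <= 2 - L]. *)
Lemma unjoined_le :
  'C(n, m)%:R ^+ 2 * expR (- (p * m%:R ^+ 2 / 2)) <= expR (2 - L).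
Proof.
have n0 : (0 < n)%N by rewrite -(ltr0n R).
have m0 : 0 < m%:R :> R by rewrite ltr0n.
have lnm : ln (n%:R / m%:R) <= L.
  rewrite ler_ln ?posrE ?divr_gt0 // ler_pdivrMr // -[leLHS]mulr1 -[leRHS]mulrA ler_pM2l //.
  by move: pm_ge L_ge2; lra.
have bin := @bin_le_expR R n m n0 isT.
apply: (@le_trans _ _ (expR (m%:R * (1 + ln (n%:R / m%:R))) ^+ 2 * expR (- (p * m%:R ^+ 2 / 2)))).
  by rewrite ler_wpM2r ?expR_ge0 // lerXn2r // nnegrE ?expR_ge0.
rewrite -expRM_natl -expRD ler_expR.
have m1 : 1 <= m%:R :> R by rewrite ler1n.
have : m%:R * (6 * L) <= m%:R * (p * m%:R) by rewrite ler_pM2l.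
have : m%:R * ln (n%:R / m%:R) <= m%:R * L by rewrite ler_pM2l.
have : 1 * (L - 2) <= m%:R * (L - 2) by rewrite ler_wpM2r // subr_ge0.
by lra.
Qed.

(** The mean number of edges is [p x^2] and [p x <= 12 L], so the threshold exceeds the mean by a
    factor of at least [expR 2], that is [lam >= 2]. *)
Lemma dense_le (x : nat) : (0 < x <= m)%N ->
  Gnnp_prob p (fun E : {set 'I_n * 'I_n} => exists X Y : {set 'I_n},
    [/\ #|X| = x, #|Y| = x &
        12 * expR 2 * L * x%:R <= #|E :&: setX X Y|%:R]) <= expR (- L) ^+ x.
Proof.
case/andP=> x0 xm; have n0 : (0 < n)%N by rewrite -(ltr0n R).
have x0R : 0 < x%:R :> R by rewrite ltr0n.
set s := 12 * expR 2 * L.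
have s_ge : 12 * L <= s by rewrite /s -mulrA ler_pM2l // ler_peMl // ltW.
have s0 : 0 < s by move: L_gt0; lra.
have px0 : 0 < p * x%:R by rewrite mulr_gt0.
have px_le : p * x%:R <= 12 * L.
  by apply: le_trans pm_le; rewrite ler_pM2l // ler_nat.
(* The optimal Chernoff exponent for mean [p x^2] and threshold [s x]. *)
pose lam := ln (s / (p * x%:R)).
have expR_lam : expR lam = s / (p * x%:R) by rewrite lnK // posrE divr_gt0.
have lam2 : 2 <= lam.
  rewrite -[2]expRK ler_ln ?posrE ?divr_gt0 ?expR_gt0 // ler_pdivlMr //.
  by rewrite /s mulrAC mulrC ler_pM2r ?expR_gt0.
have lam0 : 0 < lam by exact: lt_le_trans lam2.
apply: le_trans (Gnnp_dense n p01 x s lam0) _.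
have -> : p * x%:R ^+ 2 * (expR lam - 1) = s * x%:R - p * x%:R ^+ 2.
  by rewrite expR_lam; field; rewrite !gt_eqF.
have lnx : ln (n%:R / x%:R) <= L + lam.
  rewrite -lnM ?posrE ?divr_gt0 // ler_ln ?posrE ?divr_gt0 ?mulr_gt0 ?invr_gt0 //.
  rewrite (_ : q * _ = n%:R / x%:R * s); last by field; rewrite !gt_eqF.
  by rewrite ler_peMr ?divr_ge0 //; move: s_ge L_ge2; lra.
have bin := @bin_le_expR R n x n0 x0.
have bin2 : 'C(n, x)%:R ^+ 2 <= expR (x%:R * (1 + ln (n%:R / x%:R))) ^+ 2 :> R.
  by rewrite lerXn2r // nnegrE ?expR_ge0.
apply: le_trans (ler_wpM2r (expR_ge0 _) bin2) _.
rewrite -!expRM_natl -expRD ler_expR.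
(* The exponent is at most [x (2 + 2 L + s - (s - 2) lam)]. This decreases in [lam], and at
   [lam = 2] it equals [x (6 + 2 L - s) <= - x L]. *)
have : 0 <= p * x%:R ^+ 2 by rewrite mulr_ge0 ?exprn_ge0 // ltW.
have : x%:R * ln (n%:R / x%:R) <= x%:R * (L + lam) by rewrite ler_pM2l.
have : x%:R * ((s - 2) * 2) <= x%:R * ((s - 2) * lam).
  by rewrite ler_pM2l // ler_wpM2l //; move: L_ge2; lra.
have : x%:R * (6 + 3 * L) <= x%:R * s by rewrite ler_pM2l //; move: L_ge2; lra.
by lra.
Qed.

(** The local lemma is applied twice: neighbourhoods of vertices of [A] govern the colouring [g] of
    [B], and those of vertices of [B] govern the colouring [f] of [A]. *)
Lemma rigid_of_pseudorandom (E : {set 'I_n * 'I_n}) :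
  degrees_between (delta * q) (C * q) E ->
  (forall X Y : {set 'I_n}, #|X| = m -> #|Y| = m -> E :&: setX X Y != set0) ->
  (forall x, (0 < x <= m)%N -> forall X Y : {set 'I_n}, #|X| = x -> #|Y| = x ->
    #|E :&: setX X Y|%:R < 12 * expR 2 * L * x%:R) ->
  admits_strong_bipartite_rigid_partition E d.
Proof.
move=> [degA degB] joined dense.
have [d0 d1] := andP delta01; have [C1 C6] := andP C16.
(* Half of [delta q / K], a lower bound for the mean number of neighbours of a given colour. *)
pose t := delta * q / (2 * K).
have t0 : 0 < t by rewrite divr_gt0 ?mulr_gt0.
pose D := Num.truncn (C * q).
have Cq0 : 0 <= C * q by rewrite mulr_ge0 ?(ltW q_gt0) //; lra.
have q1 : 1 <= q by move: q_large; nra.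
have D_le : D%:R <= C * q by rewrite truncn_le.
have D0 : (0 < D)%N by rewrite truncn_ge_nat //; nra.
have degAD v : (#|[set w | (v, w) \in E]| <= D)%N.
  by rewrite truncn_ge_nat //; case/andP: (degA v).
have degBD w : (#|[set v | (v, w) \in E]| <= D)%N.
  by rewrite truncn_ge_nat //; case/andP: (degB w).
have dq_ge : 48 * (K * L) <= delta * q.
  have : 576 * c * q <= delta * q by rewrite ler_pM2r.
  have := KL_le; have : 0 <= c * q by rewrite mulr_ge0 ?ltW.
  lra.
(* The exponent equals [- delta q / (12 K) <= - 4 L], so the left side is at most
   [4 (C q)^2 q / q^4 = 4 C^2 / q <= 1]. *)
have lll : 4 * (D * D)%:R * K * expR (t / 2 - delta * q / (3 * K)) <= 1.
  apply: (@le_trans _ _ (4 * (C * q) ^+ 2 * q * expR (- L) ^+ 4)).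
    apply: ler_pM; rewrite ?mulr_ge0 ?ler0n ?expR_ge0 //.
      apply: ler_pM; rewrite ?mulr_ge0 ?ler0n // natrM expr2.
      by rewrite ler_pM2l // ler_pM // ler0n.
    rewrite -expRM_natl ler_expR /t.
    rewrite (_ : _ / 2 - _ = - (delta * q / K / 12)); last by field; rewrite gt_eqF.
    rewrite mulrN lerN2 ler_pdivlMr // ler_pdivlMr //.
    by move: dq_ge; lra.
  have qL : q * expR (- L) = 1 by rewrite expRN expRL divff // gt_eqF.
  rewrite (_ : _ * _ = 4 * C ^+ 2 * expR (- L) * (q * expR (- L)) ^+ 3); last by ring.
  rewrite qL expr1n mulr1 -[leRHS]qL ler_wpM2r ?expR_ge0 //.
pose NA v := [set w | (v, w) \in E]; pose NB w := [set v | (v, w) \in E].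
have dualA w : #|[set v | w \in NA v]| = #|NB w|.
  by apply: eq_card => v; rewrite !inE.
have dualB v : #|[set w | v \in NB w]| = #|NA v|.
  by apply: eq_card => w; rewrite !inE.
have DD0 : (0 < D * D)%N by rewrite muln_gt0 D0.
have [|v|g gP] := @polychromatic_coloring R _ _ NA d (D * D) (delta * q) t DD0 _ _ lll.
- by move=> v; apply: card_meeting_sets => // w; rewrite dualA; exact: degBD.
- by case/andP: (degA v).
have [|w|f fP] := @polychromatic_coloring R _ _ NB d (D * D) (delta * q) t DD0 _ _ lll.
- by move=> w; apply: card_meeting_sets => // v; rewrite dualB; exact: degAD.
- by case/andP: (degB w).
have KC0 : 0 < K * C by rewrite mulr_gt0 //; lra.
have class_large k : n%:R * t <= k * (C * q) -> n%:R * delta <= k * (2 * K * C).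
  rewrite /t mulrA ler_pdivrMr ?mulr_gt0 // => h.
  by rewrite -(ler_pM2r q_gt0); move: h; lra.
(* The constant 576 comes from here: [4 K C p m <= 48 C K L <= 288 K L <= 576 c q <= delta q]. *)
have size_m k : n%:R * t <= k%:R * (C * q) -> (2 * m <= k)%N.
  move=> /class_large h; rewrite -(ler_nat R) -(ler_pM2r (_ : 0 < 2 * K * C)); last by rewrite -mulrA mulr_gt0.
  apply: le_trans h; rewrite -(ler_pM2r p_gt0) natrM.
  have : K * C * (p * m%:R) <= K * C * (12 * L) by rewrite ler_pM2l.
  have : C * (K * L) <= 6 * (K * L) by rewrite ler_pM2r // mulr_gt0.
  have : 576 * c * q <= delta * q by rewrite ler_pM2r.
  move: KL_le; lra.
(* [K^2 C <= n delta <= 2 k K C], hence [d + 1 <= 2 k]. *)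
have size_d k : n%:R * t <= k%:R * (C * q) -> (uphalf d <= k)%N.
  move=> /class_large h; suff : (d.+1 <= 2 * k)%N by rewrite leq_uphalf_double -mul2n; exact: ltnW.
  rewrite -(ler_nat R) -(ler_pM2r KC0).
  by move: (le_trans d_sqrt h); rewrite natrM; lra.
have sizeA i : n%:R * t <= #|[set a | f a == i]|%:R * (C * q).
  rewrite -[n in n%:R * t]card_ord; apply: (@color_class_large _ _ _ _ NB) => [w|v].
    exact: fP.
  by rewrite dualB; case/andP: (degA v).
have sizeB j : n%:R * t <= #|[set b | g b == j]|%:R * (C * q).
  rewrite -[n in n%:R * t]card_ord; apply: (@color_class_large _ _ _ _ NA) => [v|w].
    exact: gP.
  by rewrite dualA; case/andP: (degB w).
have lemn : (m <= n)%N.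
  apply: leq_trans (leq_pmull _ (isT : (0 < 2)%N)) _.
  apply: leq_trans (size_m _ (sizeA ord0)) _.
  by rewrite -[leqRHS]card_ord max_card.
apply: (@rigid_of_colorings R _ _ E d m t f g) => //.
- by move=> i; exact/size_m/sizeA.
- by move=> j; exact/size_m/sizeB.
- move=> X Y /exists_subset_card[X' sX cX] /exists_subset_card[Y' sY cY].
  case/set0Pn: (joined _ _ cX cY) => e /setIP[eE eXY]; apply/set0Pn; exists e.
  by rewrite inE eE (subsetP (setXS sX sY)).
(* [dense] speaks of sets of exactly [x] elements, so smaller sets are padded, which [m <= n]
   permits. Its threshold is below [t x] because [24 expR 2 K L <= 48 expR 2 c q <= delta q]. *)
- move=> X Y x /[dup] xm /andP[x0 lexm] leX leY.
  have lexn : (x <= #|'I_n|)%N by rewrite card_ord (leq_trans lexm).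
  have [|X' sX cX] := @exists_superset_card _ X x; first by rewrite leX.
  have [|Y' sY cY] := @exists_superset_card _ Y x; first by rewrite leY.
  apply: (@le_lt_trans _ _ #|E :&: setX X' Y'|%:R).
    by rewrite ler_nat subset_leq_card // setIS // setXS.
  apply: lt_le_trans (dense x xm _ _ cX cY) _; rewrite ler_wpM2r // /t.
  rewrite ler_pdivlMr ?mulr_gt0 //.
  have : 576 * expR 2 * c * q <= delta * q by rewrite ler_pM2r.
  have : expR 2 * (K * L) <= expR 2 * (2 * c * q) by rewrite ler_pM2l ?expR_gt0.
  have : 0 <= expR 2 * c * q by rewrite !mulr_ge0 ?expR_ge0 ?ltW.
  lra.
- by move=> i; exact/size_d/sizeA.
Qed.

(** Union bound over the three ways to fail; dense pairs of sizes [x.+1] contribute a geometric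
    series of ratio [expR (- L) = 1 / q]. *)
Lemma Gnnp_not_rigid :
  Gnnp_prob p (fun E : {set 'I_n * 'I_n} =>
    ~ admits_strong_bipartite_rigid_partition E d)
  <= Gnnp_prob p (fun E : {set 'I_n * 'I_n} =>
       ~ degrees_between (delta * q) (C * q) E) + expR (2 - L) + 2 * expR (- L).
Proof.
pose unjoined (E : {set 'I_n * 'I_n}) :=
  exists X Y : {set 'I_n}, [/\ #|X| = m, #|Y| = m & E :&: setX X Y = set0].
pose dense x (E : {set 'I_n * 'I_n}) := exists X Y : {set 'I_n},
  [/\ #|X| = x, #|Y| = x & 12 * expR 2 * L * x%:R <= #|E :&: setX X Y|%:R].
apply: (@le_trans _ _ (Gnnp_prob p (fun E =>
    (~ degrees_between (delta * q) (C * q) E \/ unjoined E) \/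
    exists2 x : 'I_m, xpredT x & dense x.+1 E))).
  apply: Gnnp_prob_le => // E bad; apply: contrapT => /not_orP[/not_orP[h1 h2] h3].
  apply: bad; apply: rigid_of_pseudorandom.
  - exact: contrapT.
  - move=> X Y cX cY; apply/eqP => EXY; apply: h2; by exists X, Y.
  - move=> [//|x] /andP[_ xm] X Y cX cY; rewrite ltNge; apply/negP => le_e.
    by apply: h3; exists (Ordinal xm) => //; exists X, Y.
apply: le_trans (Gnnp_prob_or p01 _ _) _; apply: lerD.
  apply: le_trans (Gnnp_prob_or p01 _ _) _; rewrite lerD2l.
  apply: le_trans (Gnnp_unjoined n p01 m) unjoined_le.
apply: le_trans (Gnnp_prob_exists p01 _ _) _.
apply: le_trans (_ : \sum_(x < m) expR (- L) ^+ x.+1 <= _).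
  by apply: ler_sum => x _; apply: dense_le => /=.
apply: geometric_sum_le; rewrite expR_ge0 expRN expRL /=.
rewrite -[1 / 2]invf_div divr1 lef_pV2 ?posrE //.
by move: q_large (andP C16); nra.
Qed.

End PseudorandomGraph.

(** * Choice of parameters in the dense and sparse ranges of [p] *)

Lemma expR_le_inv (R : realType) (x : R) : x < 1 -> expR x <= (1 - x)^-1.
Proof.
move=> x1; rewrite -[x in leLHS]opprK expRN lef_pV2 ?posrE ?expR_gt0 ?subr_gt0 //.
exact: expR_ge1Dx.
Qed.

(** [q >= 1 + L^2 / 2] and [c L >= 2] give [c q / L >= 1], which absorbs the successor. *)
Lemma rigid_dim_small (R : realType) (n : nat) (p c : R) :
  0 < c -> 2 <= ln (n%:R * p) -> 2 / c <= ln (n%:R * p) ->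
  (rigid_dim n p c).+1%:R <= 2 * c * (n%:R * p) / ln (n%:R * p) /\
  (rigid_dim n p c)%:R <= 8 / 10 * Num.sqrt n%:R :> R.
Proof.
set q := n%:R * p; set L := ln q => c0 L2 Lc.
have L0 : 0 < L by lra.
have q0 : 0 < q by rewrite ltNge; apply/negP => /(@ln0 R); rewrite -/L; lra.
have cqL : 1 <= c * q / L.
  rewrite ler_pdivlMr // mul1r.
  have : 1 + L ^+ 2 / 2 <= q.
    by rewrite -[leRHS](@lnK R) ?posrE // -/L; apply: (expR_ge1Dxn 1); exact: ltW.
  move=> hq; have : 2 <= L * c by rewrite -ler_pdivrMr.
  have : c * (1 + L ^+ 2 / 2) <= c * q by rewrite ler_pM2l.
  by nra.
have min0 : 0 <= Num.min (c * q / L) (8 / 10 * Num.sqrt n%:R).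
  by rewrite le_min; apply/andP; split; [lra|rewrite mulr_ge0 ?sqrtr_ge0].
have : (rigid_dim n p c)%:R <= Num.min (c * q / L) (8 / 10 * Num.sqrt n%:R).
  by rewrite truncn_le.
rewrite le_min => /andP[h1 h2]; split=> //.
by rewrite -natr1; lra.
Qed.

(** Degree tails of size [n^-(1 + kappa)] over [4 n] cases leave [4 n^-kappa]; the other errors sum
    to [(expR 2 + 2) / q]. The bound 144 is [4 C^2] at [C = 6]. *)
Lemma Gnnp_not_rigid_bound (R : realType) (n : nat) (p delta C c y z kappa : R) :
  0 <= p <= 1 -> 0 < delta <= 1 -> 1 <= C <= 6 -> 0 < c ->
  576 * expR 2 * c <= delta -> 144 <= n%:R * p ->
  2 <= ln (n%:R * p) -> 2 / c <= ln (n%:R * p) ->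
  (rigid_dim n p c).+1%:R ^+ 2 * C <= n%:R * delta ->
  0 < y -> 0 < z ->
  n%:R * p * (expR (- y) - 1) + y * (delta * (n%:R * p))
    <= - ((1 + kappa) * ln n%:R) ->
  n%:R * p * (expR z - 1) - z * (C * (n%:R * p)) <= - ((1 + kappa) * ln n%:R) ->
  Gnnp_prob p (fun E : {set 'I_n * 'I_n} =>
    ~ admits_strong_bipartite_rigid_partition E (rigid_dim n p c))
  <= 4 * expR (- (kappa * ln n%:R)) + (expR 2 + 2) / (n%:R * p).
Proof.
set q := n%:R * p => p01 delta01 C16 c0 csm q144 L2 Lc dn y0 z0 low high.
have q0 : 0 < q by lra.
have n0 : 0 < n%:R :> R.
  rewrite lt_neqAle ler0n andbT; apply/eqP => n_0; move: q0.
  by rewrite /q -n_0 mul0r ltxx.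
have [dsm _] := rigid_dim_small c0 L2 Lc.
have q4C : 4 * C ^+ 2 <= q by have := andP C16 => -[]; nra.
have := Gnnp_not_rigid p01 delta01 C16 c0 csm L2 q4C dsm dn.
have := @Gnnp_degrees R n p p01 (delta * q) (C * q) y z
  (expR (- ((1 + kappa) * ln n%:R))) y0 z0.
rewrite !ler_expR => /(_ low high).
have -> : 4 * n%:R * expR (- ((1 + kappa) * ln n%:R)) = 4 * expR (- (kappa * ln n%:R)) :> R.
  have nE : n%:R = expR (ln n%:R) :> R by rewrite lnK.
  by rewrite -mulrA [X in _ * (X * _)]nE -expRD; congr (_ * expR _); ring.
move=> hdeg h; apply: le_trans h _.
rewrite -addrA lerD // expRD expRN lnK ?posrE // -/q; lra.
Qed.

(* When [n p >= 312 ln n] the degrees lie in [[5/6 n p, 7/6 n p]], and then the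
   classes have [5/14 n / d.+1 >= d.+1 / 2] vertices even for [d = 0.8 sqrt n]. *)
Lemma Gnnp_not_rigid_dense (R : realType) (n : nat) (p c kappa : R) :
  0 <= p <= 1 -> 0 < c -> 576 * expR 2 * c <= 5 / 6 -> 144 <= ln n%:R :> R ->
  312 * ln n%:R <= n%:R * p -> 2 <= ln (n%:R * p) -> 2 / c <= ln (n%:R * p) ->
  kappa <= 1 ->
  Gnnp_prob p (fun E : {set 'I_n * 'I_n} =>
    ~ admits_strong_bipartite_rigid_partition E (rigid_dim n p c))
  <= 4 * expR (- (kappa * ln n%:R)) + (expR 2 + 2) / (n%:R * p).
Proof.
move=> p01 c0 csm l144 qlarge L2 Lc k1.
have l0 : 0 < ln n%:R :> R by apply: lt_le_trans l144; rewrite ltr0n.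
have n0 : 0 < n%:R :> R.
  by rewrite ltNge; apply/negP => /(@ln0 R) ln_0; move: l0; rewrite ln_0 ltxx.
have kl : kappa * ln n%:R <= ln n%:R by rewrite ler_piMl // ltW.
have [_ dn] := rigid_dim_small c0 L2 Lc.
apply: (Gnnp_not_rigid_bound (delta := 5 / 6) (C := 7 / 6) (y := 1 / 10) (z := 1 / 14))
  => //; clear csm L2 Lc.
- by clear; apply/andP; split; lra.
- by clear; apply/andP; split; lra.
- by move: l144 qlarge; clear; lra.
(* [ln n >= 144] gives [n >= 1 + 144^2 / 2 > 100^2], and [sqrt n >= 100] makes
   [7 / 6 (8 / 10 sqrt n + 1)^2 <= 5 / 6 n]. *)
- have n100 : 100 <= Num.sqrt n%:R :> R.
    rewrite -[100]ger0_norm // -sqrtr_sqr ler_sqrt // -[leRHS](@lnK R) ?posrE //.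
    apply: le_trans _ (expR_ge1Dxn 1 (ltW l0)).
    rewrite (_ : 2`! = 2%N) //; move: l144; clear; nra.
  have sn : Num.sqrt n%:R ^+ 2 = n%:R :> R by rewrite sqr_sqrtr // ltW.
  move: dn n100 sn (ler0n R (rigid_dim n p c)); rewrite -(natr1 (rigid_dim n p c)).
  move: (Num.sqrt _) (rigid_dim n p c)%:R => s k; clear => dn n100 <- k_ge0.
  have : (k + 1) ^+ 2 <= (8 / 10 * s + 1) ^+ 2.
    by rewrite lerXn2r ?nnegrE ?addr_ge0 ?lerD2r ?mulr_ge0 //; lra.
  have : 100 * s <= s * s by rewrite ler_pM2r //; lra.
  lra.
- have e_le : expR (- (1 / 10)) <= 10 / 11 :> R.
    apply: le_trans (expR_le_inv _) _; first by lra.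
    by rewrite opprK (_ : (1 + 1 / 10)^-1 = 10 / 11) //; field.
  move: l0 qlarge kl e_le; move: (n%:R * p) (expR _) (ln _).
  by clear => q x l l0 qlarge kl_le x_le; nra.
(* The upper tail decays at rate at least [1 / 12 - 1 / 13 = 1 / 156] per unit of [n p];
   [312 = 2 * 156] turns this into [2 ln n >= (1 + kappa) ln n]. *)
- have e_le : expR (1 / 14) <= 14 / 13 :> R.
    apply: le_trans (expR_le_inv _) _; first by lra.
    by rewrite (_ : (1 - 1 / 14)^-1 = 14 / 13) //; field.
  move: l0 qlarge kl e_le; move: (n%:R * p) (expR _) (ln _).
  by clear => q x l l0 qlarge kl_le x_le; nra.
Qed.

(* The parameters satisfy [expR (- y) = delta * y = u] with
   [(1 - 2 u) (1 + eps) >= 1 + kappa], which makes the lower tail at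
   [delta n p] smaller than [n `^ (- (1 + kappa))]. *)
Lemma Gnnp_not_rigid_sparse (R : realType) (n : nat) (p c kappa eps delta y : R) :
  0 <= p <= 1 -> 0 < c -> 576 * expR 2 * c <= delta -> 0 < delta <= 1 ->
  0 < y -> expR (- y) = delta * y -> 0 < eps -> 0 < kappa <= 1 ->
  1 + kappa <= (1 - 2 * expR (- y)) * (1 + eps) ->
  144 <= ln n%:R :> R -> 36 * 312 ^+ 2 / delta <= ln n%:R ->
  (1 + eps) * ln n%:R <= n%:R * p < 312 * ln n%:R ->
  2 <= ln (n%:R * p) -> 2 / c <= ln (n%:R * p) ->
  Gnnp_prob p (fun E : {set 'I_n * 'I_n} =>
    ~ admits_strong_bipartite_rigid_partition E (rigid_dim n p c))
  <= 4 * expR (- (kappa * ln n%:R)) + (expR 2 + 2) / (n%:R * p).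
Proof.
move=> p01 c0 csm /[dup] delta01 /andP[d0 d1] y0 yE eps0 /andP[k0 k1] keps l144 ldelta
  /andP[qge qlt] L2 Lc.
have l0 : 0 < ln n%:R :> R by apply: lt_le_trans l144; rewrite ltr0n.
have n0 : 0 < n%:R :> R.
  by rewrite ltNge; apply/negP => /(@ln0 R) ln_0; move: l0; rewrite ln_0 ltxx.
have q0 : 0 < n%:R * p by apply: lt_le_trans qge; rewrite mulr_gt0 // addr_gt0.
have kl : kappa * ln n%:R <= ln n%:R by rewrite ler_piMl // ltW.
have [dK _] := rigid_dim_small c0 L2 Lc.
have c1 : 2 * c <= 1.
  have e2 : 1 <= expR 2 :> R by apply: le_trans _ (expR_ge1Dx _); lra.
  have : c <= expR 2 * c by rewrite ler_peMl // ltW.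
  by move: csm d1; clear; lra.
apply: (Gnnp_not_rigid_bound (delta := delta) (C := 6) (y := y) (z := 1 / 2))
  => //; clear csm Lc.
- by clear; apply/andP; split; lra.
- by move: l144 qge l0 eps0; clear; nra.
(* With [K = d + 1] and [l = ln n], [K <= n p <= 312 l], so [6 K^2 <= 6 * 312^2 l^2 <= delta l^3 / 6
   <= delta n]; this is the source of [36 * 312 ^+ 2 / delta]. *)
- have Kq : (rigid_dim n p c).+1%:R <= 312 * ln n%:R :> R.
    apply: le_trans _ (ltW qlt); apply: le_trans dK _.
    rewrite ler_pdivrMr ?(lt_le_trans _ L2) //.
    have : 2 * c * (n%:R * p) <= n%:R * p by rewrite ler_piMl // ltW.
    by move: L2 q0; clear; nra.
  have Kq2 : (rigid_dim n p c).+1%:R ^+ 2 <= (312 * ln n%:R) ^+ 2 :> R.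
    by rewrite lerXn2r ?nnegrE ?ler0n ?Kq ?mulr_ge0 ?ler0n ?(ltW l0).
  have n3 : ln n%:R ^+ 3 / 6 <= n%:R :> R.
    rewrite -[leRHS](@lnK R) ?posrE //.
    have := expR_ge1Dxn 2 (ltW l0); rewrite (_ : 3`! = 6%N) //; clear; lra.
  have {}ldelta : 36 * 312 ^+ 2 <= ln n%:R * delta by rewrite -ler_pdivrMr.
  move: n3 ldelta Kq2 l0 d0.
  move: n%:R (rigid_dim n p c).+1%:R (ln _) => N k l; clear => n3 ldelta Kq2 l0 d0.
  have : delta * (l ^+ 3 / 6) <= delta * N by rewrite ler_pM2l.
  have : l ^+ 2 * (36 * 312 ^+ 2) <= l ^+ 2 * (l * delta) by rewrite ler_pM2l ?exprn_gt0.
  by move: Kq2; clear; lra.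
- rewrite (_ : y * _ = expR (- y) * (n%:R * p)); last by rewrite yE; ring.
  have : (1 + kappa) * ln n%:R <= (1 - 2 * expR (- y)) * (1 + eps) * ln n%:R.
    by rewrite ler_pM2r.
  have : (1 - 2 * expR (- y)) * ((1 + eps) * ln n%:R) <= (1 - 2 * expR (- y)) * (n%:R * p).
    rewrite ler_wpM2l // -(pmulr_lge0 _ (addr_gt0 ltr01 eps0)).
    by apply: le_trans keps; rewrite addr_ge0 // ltW.
  by clear; lra.
(* With [z = 1 / 2] and [C = 6] the exponent is at most [n p - 3 n p = - 2 n p <= - 2 ln n]. *)
- have e_le : expR (1 / 2) <= 2 :> R.
    apply: le_trans (expR_le_inv _) _; first by lra.
    by rewrite (_ : (1 - 1 / 2)^-1 = 2) //; field.
  have lq : ln n%:R <= n%:R * p by move: qge l0 eps0; clear; nra.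
  move: l0 lq kl e_le; move: (n%:R * p) (expR _) (ln _).
  by clear => q x l l0 lq kl_le x_le; nra.
Qed.

Lemma Gnnp_not_rigid_small (R : realType) (eps : R) : 0 < eps ->
  exists2 c : R, 0 < c & forall eta : R, 0 < eta -> exists B : R,
    forall (n : nat) (p : R), 0 <= p <= 1 -> B <= ln n%:R ->
      (1 + eps) * ln n%:R / n%:R <= p ->
      Gnnp_prob p (fun E : {set 'I_n * 'I_n} =>
        ~ admits_strong_bipartite_rigid_partition E (rigid_dim n p c)) <= eta.
Proof.
(* This [u] satisfies [(1 - 2 u) (1 + eps) = 1 + eps / 2], and [y = - ln u], [delta = u / y] give
   [expR (- y) = delta y = u]. *)
move=> eps0; pose u := eps / (4 * (1 + eps)).
have u0 : 0 < u by rewrite divr_gt0 //; lra.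
have u4 : u <= 1 / 4 by rewrite /u ler_pdivrMr; lra.
have uE : u * (1 + eps) = eps / 4 by rewrite /u; field; lra.
pose y := - ln u.
have y34 : 3 / 4 <= y.
  have : ln (1 + (u - 1)) <= u - 1 by apply: le_ln1Dx; lra.
  by rewrite addrCA subrr addr0 /y; lra.
have y0 : 0 < y by lra.
have expRy : expR (- y) = u by rewrite opprK lnK.
pose delta := u / y.
have delta0 : 0 < delta by rewrite divr_gt0.
(* As [1 / 3 <= 5 / 6], the same [c] serves the dense range. *)
have delta3 : delta <= 1 / 3 by rewrite ler_pdivrMr //; lra.
pose kappa := Num.min (eps / 2) 1.
have k0 : 0 < kappa by rewrite lt_min; apply/andP; split; lra.
have k_eps : kappa <= eps / 2 by rewrite ge_min lexx.
have k1 : kappa <= 1 by rewrite ge_min lexx orbT.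
have e0 : 0 < 576 * expR 2 :> R by apply: mulr_gt0; rewrite ?ltr0n ?expR_gt0.
pose c := delta / (576 * expR 2).
have c0 : 0 < c by exact: divr_gt0.
have cE : 576 * expR 2 * c = delta by rewrite mulrC mulfVK ?(gt_eqF e0).
exists c => // eta eta0.
(* The first entries meet the size hypotheses of both ranges, the exponential one through
   [ln n <= n p]; the last two make each error term at most [eta / 2]. *)
exists (Num.max (Num.max (Num.max 144 (expR (Num.max 2 (2 / c)))) (36 * 312 ^+ 2 / delta))
  (Num.max (8 / eta / kappa) (2 * (expR 2 + 2) / eta))) => n p p01.
rewrite !ge_max -!andbA => /and5P[l144 lexp ldelta leta1 leta2] lep.
have l0 : 0 < ln n%:R :> R by apply: lt_le_trans l144; rewrite ltr0n.
have n0 : 0 < n%:R :> R.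
  by rewrite ltNge; apply/negP => /(@ln0 R) ln_0; move: l0; rewrite ln_0 ltxx.
have q_ge : (1 + eps) * ln n%:R <= n%:R * p by rewrite [leRHS]mulrC -ler_pdivrMr.
have lq : ln n%:R <= n%:R * p by apply: le_trans q_ge; rewrite ler_peMl ?lerDl // ltW.
have q0 : 0 < n%:R * p by exact: lt_le_trans lq.
have /andP[L2 Lc] : (2 <= ln (n%:R * p)) && (2 / c <= ln (n%:R * p)).
  rewrite -ge_max -[leLHS]expRK ler_ln ?posrE ?expR_gt0 //.
  exact: le_trans lexp lq.
apply: (@le_trans _ _ (4 * expR (- (kappa * ln n%:R)) + (expR 2 + 2) / (n%:R * p))).
  have [large|small] := lerP (312 * ln n%:R) (n%:R * p).
    apply: Gnnp_not_rigid_dense => //; rewrite cE.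
    by move: delta3; clear; lra.
  apply: (Gnnp_not_rigid_sparse (eps := eps) (delta := delta) (y := y)) => //.
  - by rewrite cE.
  - by rewrite delta0; move: delta3; clear; lra.
  - by rewrite expRy divfK // gt_eqF.
  - by rewrite k0.
  - by rewrite expRy; move: k_eps uE; clear; lra.
  - by rewrite q_ge.
have le1 : 4 * expR (- (kappa * ln n%:R)) <= eta / 2.
  have lk : 8 / eta <= kappa * ln n%:R by rewrite [leRHS]mulrC -ler_pdivrMr.
  have : expR (- (kappa * ln n%:R)) <= (8 / eta)^-1.
    rewrite expRN lef_pV2 ?posrE ?expR_gt0 ?divr_gt0 //.
    by apply: le_trans _ (expR_ge1Dx _); move: lk; clear; lra.
  by rewrite invf_div; clear; lra.
have le2 : (expR 2 + 2) / (n%:R * p) <= eta / 2.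
  rewrite ler_pdivrMr //; move: leta2; rewrite ler_pdivrMr //.
  have : ln n%:R * eta <= n%:R * p * eta by rewrite ler_pM2r.
  by clear; lra.
by move: le1 le2; clear; lra.
Qed.

(** * Convergence of the probability along a sequence [p n] *)

Local Open Scope classical_set_scope.
Local Open Scope ring_scope.

Theorem theorem1p12 (R : realType) (eps : R) (heps : 0 < eps) :
  exists c : R, 0 < c /\
    forall p : nat -> R,
      (forall n : nat, 0 <= p n <= 1) ->
      (\forall n \near \oo, (1 + eps) * ln n%:R / n%:R <= p n) ->
      (fun n : nat =>
         Gnnp_prob (p n) (fun E : {set 'I_n * 'I_n} =>
           admits_strong_bipartite_rigid_partition E (rigid_dim n (p n) c)))
        @ \oo --> (1 : R).
Proof.
have [c c0 small] := Gnnp_not_rigid_small heps.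
exists c; split=> // p p01 p_large; apply/cvgrPdist_le => eta eta0.
have [B smallB] := small _ eta0.
near=> n.
rewrite -Gnnp_probC ger0_norm; last first.
  by apply: sumr_ge0 => E _; exact: Gnnp_weight_ge0.
apply: smallB => //; last by near: n.
rewrite -[B]expRK ler_ln ?posrE ?expR_gt0 //.
  by near: n; exact: nbhs_infty_ger.
rewrite ltr0n; near: n; exact: nbhs_infty_gt.
Unshelve. all: by end_near.
Qed.
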